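(* Fix $q\in\,]0,1[$ and $\omega\ge 0$, put $\omega_0=\frac{\omega}{1-q}$, and let $a<\omega_0<b$ be real numbers. Let $f:[a,b]\to\mathbb{R}$ be an absolutely $(q,\omega)$-integrable function on $[a,b]$, and suppose that there exist real numbers $m$ and $M$ such that $m\le f(x)\le M$ for all $x\in[a,b]_{q,\omega}$, where $$[a,b]_{q,\omega}=\left\{a q^n+\tfrac{1-q^n}{1-q}\omega:n\in\mathbb{N}_0\right\}\cup\left\{b q^n+\tfrac{1-q^n}{1-q}\omega:n\in\mathbb{N}_0\right\}\cup\{\omega_0\}.$$ If $u:[a,b]\to\mathbb{R}$ is $(q,\omega)$-$L$-Lipschitzian on $[a,b]_{q,\omega}$ and $\lim_{n\to\infty}u\left(x q^n+\frac{1-q^n}{1-q}\omega\right)$ exists for $x=a$ and for $x=b$, then $$\left|\int_a^b f(x)\,d_{q,\omega}u(x)-\frac{u(b)-u(a)-\left(u(\omega_0^+)-u(\omega_0^-)\right)}{b-a}\int_a^b f(t)\,d_{q,\omega}t\right|\le\frac12 L(M-m)(b-a).$$ The constant $\frac12$ is the best possible: there is no constant $c<\frac12$ such that the inequality with $\frac12$ replaced by $c$ holds for all admissible data $(a,b,f,u,m,M,L)$.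
   Context: Let $\beta(t)=qt+\omega$ on $\mathbb{R}$, with $0<q<1$, $\omega\ge 0$; its unique fixed point is $\omega_0=\frac{\omega}{1-q}$, and its $k$-fold iterate is $\beta^k(t)=tq^k+\frac{1-q^k}{1-q}\omega$ ($\beta^0(t)=t$). The Jackson–Thomae–Nörlund $(q,\omega)$-integral is $\int_a^b h(x)\,d_{q,\omega}x:=\int_{\omega_0}^b h\,d_{q,\omega}-\int_{\omega_0}^a h\,d_{q,\omega}$ with $\int_{\omega_0}^x h\,d_{q,\omega}:=\sum_{k=0}^\infty\big(\beta^k(x)-\beta^{k+1}(x)\big)h(\beta^k(x))$. The function $h$ is $(q,\omega)$-integrable on $[a,b]$ if these series converge for $x=a$ and $x=b$, and absolutely $(q,\omega)$-integrable if $|h|$ is $(q,\omega)$-integrable. The Riemann–Stieltjes $(q,\omega)$-integral with respect to $u$ is $$\int_a^b f(x)\,d_{q,\omega}u(x):=\sum_{k=0}^\infty f(\beta^k(b))\big(u(\beta^k(b))-u(\beta^{k+1}(b))\big)-\sum_{k=0}^\infty f(\beta^k(a))\big(u(\beta^k(a))-u(\beta^{k+1}(a))\big).$$ A real function $u$ is $(q,\omega)$-$L$-Lipschitzian on $[a,b]_{q,\omega}$ if $|u(x)-u(qx+\omega)|\le L|x-(qx+\omega)|$ for all $x\in[a,b]_{q,\omega}$. Notation: $u(\omega_0^+):=\lim_{n\to\infty}u(\beta^n(b))$ and $u(\omega_0^-):=\lim_{n\to\infty}u(\beta^n(a))$. *)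

(* Defs.v *)
From Stdlib Require Import Reals Lra.
From Coquelicot Require Import Coquelicot.
Open Scope R_scope.

Definition beta (q w t : R) : R := q * t + w.

Definition omega0 (q w : R) : R := w / (1 - q).

Definition beta_iter (q w : R) (k : nat) (t : R) : R := Nat.iter k (beta q w) t.

Lemma beta_iter_closed (q w : R) (k : nat) (t : R) :
  q <> 1 -> beta_iter q w k t = t * q ^ k + (1 - q ^ k) / (1 - q) * w.
Proof.
  intros Hq. unfold beta_iter.
  induction k as [|k IH]; simpl.
  - field. lra.
  - rewrite IH. unfold beta. field. lra.
Qed.

Definition qw_lattice (q w a b x : R) : Prop :=
  (exists n : nat, x = beta_iter q w n a) \/
  (exists n : nat, x = beta_iter q w n b) \/
  x = omega0 q w.

(* Functions on [a, b] are represented by total functions on R: every notion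
   below evaluates them only on the lattice, which lies in [a, b] when
   a < omega0 < b. *)

Definition qw_term (q w : R) (h : R -> R) (x : R) (k : nat) : R :=
  (beta_iter q w k x - beta_iter q w (S k) x) * h (beta_iter q w k x).

Definition qw_integrable (q w : R) (h : R -> R) (a b : R) : Prop :=
  ex_series (qw_term q w h a) /\ ex_series (qw_term q w h b).

Definition qw_abs_integrable (q w : R) (h : R -> R) (a b : R) : Prop :=
  qw_integrable q w (fun x => Rabs (h x)) a b.

Definition qw_integral (q w : R) (h : R -> R) (a b : R) : R :=
  Series (qw_term q w h b) - Series (qw_term q w h a).

Definition qw_stieltjes_term (q w : R) (f u : R -> R) (x : R) (k : nat) : R :=
  f (beta_iter q w k x) * (u (beta_iter q w k x) - u (beta_iter q w (S k) x)).

Definition qw_stieltjes_integrable (q w : R) (f u : R -> R) (a b : R) : Prop :=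
  ex_series (qw_stieltjes_term q w f u a) /\
  ex_series (qw_stieltjes_term q w f u b).

Definition qw_stieltjes_integral (q w : R) (f u : R -> R) (a b : R) : R :=
  Series (qw_stieltjes_term q w f u b) - Series (qw_stieltjes_term q w f u a).

Definition qw_lipschitz (q w L : R) (u : R -> R) (a b : R) : Prop :=
  forall x : R, qw_lattice q w a b x ->
    Rabs (u x - u (q * x + w)) <= L * Rabs (x - (q * x + w)).

(* The limit of u along the orbit of x: u(omega0+) for x = b, u(omega0-) for
   x = a. Meaningful only when [ex_finite_lim_seq] holds for the sequence. *)
Definition orbit_lim (q w : R) (u : R -> R) (x : R) : R :=
  real (Lim_seq (fun n => u (beta_iter q w n x))).

Record gruss_data (q w a b : R) (f u : R -> R) (m M L : R) : Prop := {
  gruss_a_lt : a < omega0 q w;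
  gruss_b_gt : omega0 q w < b;
  gruss_f_abs_integrable : qw_abs_integrable q w f a b;
  gruss_f_bounds : forall x : R, qw_lattice q w a b x -> m <= f x <= M;
  gruss_u_lipschitz : qw_lipschitz q w L u a b;
  gruss_u_lim_a : ex_finite_lim_seq (fun n => u (beta_iter q w n a));
  gruss_u_lim_b : ex_finite_lim_seq (fun n => u (beta_iter q w n b))
}.

Definition gruss_bound (c q w a b : R) (f u : R -> R) (m M L : R) : Prop :=
  Rabs (qw_stieltjes_integral q w f u a b
        - (u b - u a - (orbit_lim q w u b - orbit_lim q w u a)) / (b - a)
          * qw_integral q w f a b)
  <= c * L * (M - m) * (b - a).

(* Main.v *)
Require Import Defs.
From Stdlib Require Import Reals Lra.
From Coquelicot Require Import Coquelicot.
Open Scope R_scope.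

(** Along the orbits of [a] and [b] the [(q,w)]-integral is integration against
    a positive measure of total mass [b - a], and by telescoping
    [u(b) - u(a) - (u(omega0+) - u(omega0-))] is the integral of the slope of
    [u].  With [mu] the mean of [f], the left-hand side is therefore the
    integral of [slope * (f - mu)], at most [L] times the mean absolute
    deviation of [f].  Bounding [|y - mu|] on [[m, M]] by its chord, which has
    height at most [(M - m) / 2] at [mu], and integrating gives the constant
    [1/2].  Equality holds for [f = sign (x - omega0)], [u = |x - omega0|] on
    [[omega0 - 1, omega0 + 1]]. *)

(** * Telescoping and termwise comparison of series; a chord bound *)

Lemma is_series_telescope (v : nat -> R) (l : R) :
  is_lim_seq v l -> is_series (fun k => v k - v (S k)) (v 0%nat - l).
Proof.
  intros Hv.
  apply (is_lim_seq_ext (fun n => v 0%nat - v (S n))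
           (sum_n (fun k => v k - v (S k))) (v 0%nat - l)).
  - intros n. induction n as [|n IH].
    + now rewrite sum_O.
    + rewrite sum_Sn, <- IH. unfold plus; simpl. ring.
  - apply (is_lim_seq_minus' (fun _ => v 0%nat) (fun n => v (S n))).
    + apply is_lim_seq_const.
    + now apply (is_lim_seq_incr_1 v l).
Qed.

Lemma is_series_le (s t : nat -> R) (ls lt : R) :
  (forall n, s n <= t n) -> is_series s ls -> is_series t lt -> ls <= lt.
Proof.
  intros Hle Hs Ht.
  apply (is_lim_seq_le (sum_n s) (sum_n t) ls lt); [|exact Hs|exact Ht].
  intros n. now apply sum_n_m_le.
Qed.

(** By convexity [y |-> |y - mu|] lies below its chord through [(m, mu - m)] and [(M, M - mu)]; [A]
    is the height of that chord at [mu] and [B] its slope. *)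
Lemma abs_sub_le_chord (m M mu : R) :
  m <= mu <= M ->
  exists A B : R, A <= (M - m) / 2 /\
    forall y, m <= y <= M -> Rabs (y - mu) <= A + B * (y - mu).
Proof.
  intros Hmu. destruct (Req_dec m M) as [E|N].
  - exists 0, 0. split; [lra|]. intros y Hy.
    replace (y - mu) with 0 by lra. rewrite Rabs_R0. lra.
  - assert (Hpos : 0 < M - m) by lra.
    exists (2 * (mu - m) * (M - mu) / (M - m)), ((m + M - 2 * mu) / (M - m)).
    split.
    + apply Rmult_le_reg_r with (M - m); [lra|].
      replace (2 * (mu - m) * (M - mu) / (M - m) * (M - m))
        with (2 * (mu - m) * (M - mu)) by (field; lra).
      (* The square is [(M - m)^2 - 4 * (mu - m) * (M - mu)]. *)
      assert (0 <= (m + M - 2 * mu) ^ 2) by apply pow2_ge_0. nra.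
    + intros y Hy.
      (* The chord, rewritten as the interpolation of its two end values. *)
      replace (2 * (mu - m) * (M - mu) / (M - m)
               + (m + M - 2 * mu) / (M - m) * (y - mu))
        with (((M - y) * (mu - m) + (y - m) * (M - mu)) / (M - m))
        by (field; lra).
      apply Rabs_le. split; apply Rmult_le_reg_r with (M - m); try lra;
        [replace (- (((M - y) * (mu - m) + (y - m) * (M - mu)) / (M - m)) * (M - m))
           with (- ((M - y) * (mu - m) + (y - m) * (M - mu))) by (field; lra)
        |replace (((M - y) * (mu - m) + (y - m) * (M - mu)) / (M - m) * (M - m))
           with ((M - y) * (mu - m) + (y - m) * (M - mu)) by (field; lra)].
      (* After clearing [M - m], the slack in each of the two bounds is twice the asserted
         product. *)
      * assert (0 <= (y - m) * (M - mu)) by (apply Rmult_le_pos; lra). nra.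
      * assert (0 <= (M - y) * (mu - m)) by (apply Rmult_le_pos; lra). nra.
Qed.

(** * Orbits of [beta], centred at the fixed point, and their weights *)

Lemma beta_iter_omega0 (q w x : R) (k : nat) :
  q <> 1 -> beta_iter q w k x = omega0 q w + (x - omega0 q w) * q ^ k.
Proof.
  intros Hq. rewrite beta_iter_closed by exact Hq.
  unfold omega0. field. lra.
Qed.

Lemma is_lim_seq_beta_iter (q w x : R) :
  0 < q < 1 -> is_lim_seq (fun k => beta_iter q w k x) (omega0 q w).
Proof.
  intros Hq.
  apply (is_lim_seq_ext (fun k => omega0 q w + (x - omega0 q w) * q ^ k)).
  { intros k. symmetry. apply beta_iter_omega0. lra. }
  replace (Finite (omega0 q w))
    with (Finite (omega0 q w + (x - omega0 q w) * 0)) by (f_equal; ring).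
  apply is_lim_seq_plus'; [apply is_lim_seq_const|].
  apply is_lim_seq_mult'; [apply is_lim_seq_const|].
  apply is_lim_seq_geom. apply Rabs_def1; lra.
Qed.

(* [s] is the sign of [x - omega0], which makes the weights
   [s * (x_k - x_(k+1))] of the orbit [x_k] of [x] nonnegative; their sum is
   [s * (x - omega0)]. *)
Lemma orbit_weight_ge0 (q w x s : R) (k : nat) :
  0 < q < 1 -> 0 <= s * (x - omega0 q w) ->
  0 <= s * (beta_iter q w k x - beta_iter q w (S k) x).
Proof.
  intros Hq Hs. rewrite !beta_iter_omega0 by lra. simpl.
  replace (s * _) with (s * (x - omega0 q w) * ((1 - q) * q ^ k)) by ring.
  apply Rmult_le_pos; [exact Hs|].
  apply Rmult_le_pos; [lra|]. apply pow_le. lra.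
Qed.

Lemma orbit_weight_abs (q w x s : R) (k : nat) :
  0 < q < 1 -> Rabs s = 1 -> 0 <= s * (x - omega0 q w) ->
  Rabs (beta_iter q w k x - beta_iter q w (S k) x)
  = s * (beta_iter q w k x - beta_iter q w (S k) x).
Proof.
  intros Hq H1 Hs.
  rewrite <- (Rabs_pos_eq (s * _)) by now apply orbit_weight_ge0.
  rewrite Rabs_mult, H1. ring.
Qed.

Lemma is_series_orbit_weight (q w x : R) :
  0 < q < 1 ->
  is_series (fun k => beta_iter q w k x - beta_iter q w (S k) x)
    (x - omega0 q w).
Proof.
  intros Hq.
  exact (is_series_telescope (fun k => beta_iter q w k x) _
           (is_lim_seq_beta_iter q w x Hq)).
Qed.

(** * Convergence and estimates along a single orbit *)

Lemma ex_series_qw_term (q w x s : R) (f : R -> R) :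
  0 < q < 1 -> Rabs s = 1 -> 0 <= s * (x - omega0 q w) ->
  ex_series (qw_term q w (fun y => Rabs (f y)) x) ->
  ex_series (qw_term q w f x).
Proof.
  intros Hq H1 Hs Hf.
  apply (@ex_series_le R_AbsRing R_CompleteNormedModule _
     (fun k => s * qw_term q w (fun y => Rabs (f y)) x k)).
  - intros k. change (Rabs (qw_term q w f x k)
      <= s * qw_term q w (fun y => Rabs (f y)) x k).
    unfold qw_term.
    rewrite Rabs_mult, (orbit_weight_abs q w x s) by assumption.
    right. ring.
  - exact (ex_series_scal s _ Hf).
Qed.

Lemma stieltjes_increment_le (q w x s L : R) (u : R -> R) (k : nat) :
  0 < q < 1 -> Rabs s = 1 -> 0 <= s * (x - omega0 q w) ->
  (forall j, Rabs (u (beta_iter q w j x) - u (beta_iter q w (S j) x))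
     <= L * Rabs (beta_iter q w j x - beta_iter q w (S j) x)) ->
  Rabs (u (beta_iter q w k x) - u (beta_iter q w (S k) x))
  <= L * (s * (beta_iter q w k x - beta_iter q w (S k) x)).
Proof.
  intros Hq H1 Hs Hu. rewrite <- orbit_weight_abs by assumption. apply Hu.
Qed.

(** The Lipschitz condition turns increments of [u] into weights, so the terms are dominated by [L]
    times those of the integral of [|f|]. *)
Lemma ex_series_stieltjes (q w x s L : R) (f u : R -> R) :
  0 < q < 1 -> Rabs s = 1 -> 0 <= s * (x - omega0 q w) ->
  ex_series (qw_term q w (fun y => Rabs (f y)) x) ->
  (forall j, Rabs (u (beta_iter q w j x) - u (beta_iter q w (S j) x))
     <= L * Rabs (beta_iter q w j x - beta_iter q w (S j) x)) ->
  ex_series (qw_stieltjes_term q w f u x).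
Proof.
  intros Hq H1 Hs Hf Hu.
  apply (@ex_series_le R_AbsRing R_CompleteNormedModule _
    
    (fun k => L * s * qw_term q w (fun y => Rabs (f y)) x k)).
  - intros k. change (Rabs (qw_stieltjes_term q w f u x k)
      <= L * s * qw_term q w (fun y => Rabs (f y)) x k).
    unfold qw_stieltjes_term, qw_term. rewrite Rabs_mult.
    pose proof (stieltjes_increment_le q w x s L u k Hq H1 Hs Hu) as Hk.
    pose proof (Rabs_pos (f (beta_iter q w k x))). nra.
  - exact (ex_series_scal (L * s) _ Hf).
Qed.

(** Serves to place the mean of [f] over both orbits in [[m, M]]. *)
Lemma qw_series_bounds (q w x s m M : R) (f : R -> R) :
  0 < q < 1 -> 0 <= s * (x - omega0 q w) ->
  ex_series (qw_term q w f x) ->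
  (forall k, m <= f (beta_iter q w k x) <= M) ->
  m * (s * (x - omega0 q w)) <= s * Series (qw_term q w f x)
    <= M * (s * (x - omega0 q w)).
Proof.
  intros Hq Hs Hf Hb.
  pose proof (is_series_scal s _ _ (Series_correct _ Hf)) as HI.
  pose proof (is_series_scal s _ _ (is_series_orbit_weight q w x Hq)) as HW.
  split.
  - refine (is_series_le _ _ _ _ _ (is_series_scal m _ _ HW) HI).
    intros k. pose proof (orbit_weight_ge0 q w x s k Hq Hs).
    specialize (Hb k). unfold scal, qw_term; simpl; unfold mult; simpl in *.
    nra.
  - refine (is_series_le _ _ _ _ _ HI (is_series_scal M _ _ HW)).
    intros k. pose proof (orbit_weight_ge0 q w x s k Hq Hs).
    specialize (Hb k). unfold scal, qw_term; simpl; unfold mult; simpl in *.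
    nra.
Qed.

(** One orbit's share of the estimate. The part with slope [B] must be kept: [mu] is the mean over
    both orbits together, so that part cancels only once they are added. *)
Lemma orbit_deviation_le (q w x s L mu A B : R) (f u : R -> R) :
  0 < q < 1 -> Rabs s = 1 -> 0 <= s * (x - omega0 q w) -> 0 <= L ->
  ex_series (qw_term q w (fun y => Rabs (f y)) x) ->
  (forall k, Rabs (u (beta_iter q w k x) - u (beta_iter q w (S k) x))
     <= L * Rabs (beta_iter q w k x - beta_iter q w (S k) x)) ->
  ex_finite_lim_seq (fun n => u (beta_iter q w n x)) ->
  (forall k, Rabs (f (beta_iter q w k x) - mu)
     <= A + B * (f (beta_iter q w k x) - mu)) ->
  Rabs (Series (qw_stieltjes_term q w f u x) - mu * (u x - orbit_lim q w u x))
  <= L * ((A - B * mu) * (s * (x - omega0 q w))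
          + B * (s * Series (qw_term q w f x))).
Proof.
  intros Hq H1 Hs HL Hf Hu Hlim Hc.
  pose proof (ex_series_qw_term q w x s f Hq H1 Hs Hf) as Hf'.
  pose proof (Series_correct _ (ex_series_stieltjes q w x s L f u
                Hq H1 Hs Hf Hu)) as HS.
  pose proof (is_series_telescope _ _ (Lim_seq_correct' _ Hlim)) as HU.
  change (is_series (fun k => u (beta_iter q w k x) - u (beta_iter q w (S k) x))
            (u x - orbit_lim q w u x)) in HU.
  pose proof (is_series_minus _ _ _ _ HS (is_series_scal mu _ _ HU)) as HD.
  (* The majorant is [L * (A + B * (f - mu))] times the weight, regrouped into a constant part and a
     multiple of [f]. *)
  pose proof (is_series_scal L _ _
    (is_series_plus _ _ _ _
      (is_series_scal (A - B * mu) _ _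
        (is_series_scal s _ _ (is_series_orbit_weight q w x Hq)))
      (is_series_scal B _ _
        (is_series_scal s _ _ (Series_correct _ Hf'))))) as HE.
  assert (Hk : forall k,
    Rabs (f (beta_iter q w k x)
            * (u (beta_iter q w k x) - u (beta_iter q w (S k) x))
          - mu * (u (beta_iter q w k x) - u (beta_iter q w (S k) x)))
    <= L * ((A - B * mu) * (s * (beta_iter q w k x - beta_iter q w (S k) x))
            + B * (s * ((beta_iter q w k x - beta_iter q w (S k) x)
                        * f (beta_iter q w k x))))).
  { intros k. rewrite <- Rmult_minus_distr_r, Rabs_mult.
    pose proof (stieltjes_increment_le q w x s L u k Hq H1 Hs Hu) as Hi.
    pose proof (Rmult_le_compat _ _ _ _ (Rabs_pos _) (Rabs_pos _) (Hc k) Hi).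
    lra. }
  apply Rabs_le. split.
  - refine (is_series_le _ _ _ _ _ (is_series_opp _ _ HE) HD).
    intros k. specialize (Hk k). apply Rabs_le_between in Hk. apply Hk.
  - refine (is_series_le _ _ _ _ _ HD HE).
    intros k. specialize (Hk k). apply Rabs_le_between in Hk. apply Hk.
Qed.

(** * The inequality with constant [1 / 2] *)

Lemma qw_gruss_inequality (q w a b : R) (f u : R -> R) (m M L : R) :
  0 < q < 1 -> gruss_data q w a b f u m M L ->
  qw_stieltjes_integrable q w f u a b /\
  gruss_bound (1 / 2) q w a b f u m M L.
Proof.
  intros Hq [Ha Hb [Hfa Hfb] Hm Hu Hla Hlb].
  assert (Ia : forall k, qw_lattice q w a b (beta_iter q w k a))
    by (intros k; left; now exists k).
  assert (Ib : forall k, qw_lattice q w a b (beta_iter q w k b))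
    by (intros k; right; left; now exists k).
  assert (Ua := fun k => Hu _ (Ia k)).
  assert (Ub := fun k => Hu _ (Ib k)).
  assert (Sa : 0 <= -1 * (a - omega0 q w)) by lra.
  assert (Sb : 0 <= 1 * (b - omega0 q w)) by lra.
  assert (N1 : Rabs (-1) = 1) by (rewrite Rabs_left; lra).
  assert (P1 : Rabs 1 = 1) by apply Rabs_R1.
  (* The Lipschitz condition at [b], which [beta] moves because [b] is not the fixed point, forces
     the sign of [L]. *)
  assert (HL : 0 <= L).
  { specialize (Ub 0%nat). simpl in Ub.
    pose proof (Rabs_pos (u b - u (q * b + w))).
    assert (0 < Rabs (b - (q * b + w))).
    { apply Rabs_pos_lt. replace (b - (q * b + w))
        with ((b - omega0 q w) * (1 - q)) by (unfold omega0; field; lra).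
      apply Rmult_integral_contrapositive; lra. }
    nra. }
  split; [split|].
  - exact (ex_series_stieltjes q w a (-1) L f u Hq N1 Sa Hfa Ua).
  - exact (ex_series_stieltjes q w b 1 L f u Hq P1 Sb Hfb Ub).
  - unfold gruss_bound, qw_stieltjes_integral.
    pose proof (qw_series_bounds q w a (-1) m M f Hq Sa
      (ex_series_qw_term q w a (-1) f Hq N1 Sa Hfa)
      (fun k => Hm _ (Ia k))) as Ba.
    pose proof (qw_series_bounds q w b 1 m M f Hq Sb
      (ex_series_qw_term q w b 1 f Hq P1 Sb Hfb)
      (fun k => Hm _ (Ib k))) as Bb.
    set (mu := qw_integral q w f a b / (b - a)).
    assert (Emu : mu * (b - a) = qw_integral q w f a b)
      by (unfold mu; field; lra).
    assert (Hmu : m <= mu <= M).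
    { unfold qw_integral in Emu.
      split; apply Rmult_le_reg_r with (b - a); lra. }
    destruct (abs_sub_le_chord m M mu Hmu) as (A & B & HA & HAB).
    pose proof (orbit_deviation_le q w a (-1) L mu A B f u Hq N1 Sa HL Hfa Ua
      Hla (fun k => HAB _ (Hm _ (Ia k)))) as Da.
    pose proof (orbit_deviation_le q w b 1 L mu A B f u Hq P1 Sb HL Hfb Ub
      Hlb (fun k => HAB _ (Hm _ (Ib k)))) as Db.
    apply Rle_trans with (L * (A * (b - a))).
    (* The left-hand side splits into the deviation along the orbit of [b] minus that along the
       orbit of [a]. *)
    + replace (_ - _ / (b - a) * _) with
        ((Series (qw_stieltjes_term q w f u b) - mu * (u b - orbit_lim q w u b))
         - (Series (qw_stieltjes_term q w f u a)
            - mu * (u a - orbit_lim q w u a)))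
        by (unfold mu; field; lra).
      eapply Rle_trans; [apply Rabs_triang|]. rewrite Rabs_Ropp.
      eapply Rle_trans; [apply (Rplus_le_compat _ _ _ _ Db Da)|].
      right. rewrite <- Rmult_plus_distr_l. f_equal.
      unfold qw_integral in Emu.
      (* The added multiple of [B] is zero because [mu] is the mean of [f]. *)
      replace (A * (b - a)) with (A * (b - a) + B * (Series (qw_term q w f b)
        - Series (qw_term q w f a) - mu * (b - a))) by (rewrite Emu; ring).
      ring.
    + replace (1 / 2 * L * (M - m) * (b - a))
        with (L * ((M - m) / 2 * (b - a))) by field.
      apply Rmult_le_compat_l; [exact HL|].
      apply Rmult_le_compat_r; lra.
Qed.

(** * Sharpness of the constant *)

Definition extremal_f (q w x : R) : R := sign (x - omega0 q w).
Definition extremal_u (q w x : R) : R := Rabs (x - omega0 q w).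

(** The orbit point sits at signed distance [e * q ^ k] from [omega0], so it never reaches [omega0]
    or changes side. *)
Lemma extremal_on_orbit (q w e : R) (k : nat) :
  0 < q < 1 -> e = 1 \/ e = -1 ->
  extremal_f q w (beta_iter q w k (omega0 q w + e)) = e /\
  extremal_u q w (beta_iter q w k (omega0 q w + e)) = q ^ k.
Proof.
  intros Hq He. unfold extremal_f, extremal_u.
  rewrite beta_iter_omega0 by lra.
  assert (0 < q ^ k) by (apply pow_lt; lra).
  replace (_ + _ - _) with (e * q ^ k) by ring.
  destruct He as [-> | ->]; split.
  - apply sign_eq_1. lra.
  - rewrite Rabs_pos_eq; lra.
  - apply sign_eq_m1. lra.
  - rewrite Rabs_left; lra.
Qed.

Lemma is_lim_seq_extremal_u (q w e : R) :
  0 < q < 1 -> e = 1 \/ e = -1 ->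
  is_lim_seq (fun k => extremal_u q w (beta_iter q w k (omega0 q w + e))) 0.
Proof.
  intros Hq He.
  apply (is_lim_seq_ext (fun k => q ^ k)).
  - intros k. symmetry. now apply extremal_on_orbit.
  - apply is_lim_seq_geom. apply Rabs_def1; lra.
Qed.

(** Weights and values of [f] share the sign [e], so both orbits contribute the same amount and the
    integral of [f] vanishes. *)
Lemma is_series_extremal_qw_term (q w e : R) :
  0 < q < 1 -> e = 1 \/ e = -1 ->
  is_series (qw_term q w (extremal_f q w) (omega0 q w + e)) 1.
Proof.
  intros Hq He.
  replace 1 with (e * (omega0 q w + e - omega0 q w))
    by (destruct He as [-> | ->]; ring).
  eapply is_series_ext;
    [|apply (is_series_scal e _ _ (is_series_orbit_weight q w _ Hq))].
  intros k. unfold qw_term, scal; simpl; unfold mult; simpl.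
  rewrite (proj1 (extremal_on_orbit q w e k Hq He)). apply Rmult_comm.
Qed.

Lemma is_series_extremal_stieltjes (q w e : R) :
  0 < q < 1 -> e = 1 \/ e = -1 ->
  is_series (qw_stieltjes_term q w (extremal_f q w) (extremal_u q w)
               (omega0 q w + e)) e.
Proof.
  intros Hq He.
  pose proof (is_series_telescope _ _ (is_lim_seq_extremal_u q w e Hq He)) as HT.
  cbv beta in HT.
  rewrite (proj2 (extremal_on_orbit q w e 0 Hq He)) in HT.
  replace e with (e * (q ^ 0 - 0)) at 2 by (simpl; ring).
  eapply is_series_ext; [|apply (is_series_scal e _ _ HT)].
  intros k. unfold qw_stieltjes_term, scal; simpl; unfold mult; simpl.
  now rewrite (proj1 (extremal_on_orbit q w e k Hq He)).
Qed.

Lemma extremal_gruss_data (q w : R) :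
  0 < q < 1 ->
  gruss_data q w (omega0 q w + -1) (omega0 q w + 1)
    (extremal_f q w) (extremal_u q w) (-1) 1 1.
Proof.
  intros Hq.
  assert (Habs : forall e, e = 1 \/ e = -1 ->
    ex_series (qw_term q w (fun y => Rabs (extremal_f q w y))
                 (omega0 q w + e))).
  { intros e He. exists (omega0 q w + e - omega0 q w).
    eapply is_series_ext; [|apply is_series_orbit_weight, Hq].
    intros k. unfold qw_term.
    rewrite (proj1 (extremal_on_orbit q w e k Hq He)).
    replace (Rabs e) with 1; [symmetry; apply Rmult_1_r|].
    destruct He as [-> | ->]; [now rewrite Rabs_R1|rewrite Rabs_left; lra]. }
  split.
  - lra.
  - lra.
  - split; apply Habs; auto.
  - intros x _. unfold extremal_f.
    destruct (Rtotal_order 0 (x - omega0 q w)) as [H|[H|H]].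
    + rewrite sign_eq_1; lra.
    + rewrite <- H, sign_0; lra.
    + rewrite sign_eq_m1; lra.
  - intros x _. unfold extremal_u. rewrite Rmult_1_l.
    eapply Rle_trans; [apply Rabs_triang_inv2|].
    right. f_equal. ring.
  - exists 0. apply is_lim_seq_extremal_u; auto.
  - exists 0. apply is_lim_seq_extremal_u; auto.
Qed.

Theorem corollary4p20 (q w : R) (hq : 0 < q < 1) (hw : 0 <= w) :
  (forall (a b : R) (f u : R -> R) (m M L : R),
     gruss_data q w a b f u m M L ->
     qw_stieltjes_integrable q w f u a b /\
     gruss_bound (1 / 2) q w a b f u m M L) /\
  ~ (exists c : R, c < 1 / 2 /\
       forall (a b : R) (f u : R -> R) (m M L : R),
         gruss_data q w a b f u m M L ->
         gruss_bound c q w a b f u m M L).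
Proof.
  split.
  - intros a b f u m M L. now apply qw_gruss_inequality.
  - intros (c & Hc & H).
    specialize (H _ _ _ _ _ _ _ (extremal_gruss_data q w hq)).
    unfold gruss_bound, qw_stieltjes_integral, qw_integral in H.
    rewrite !(is_series_unique _ _ (is_series_extremal_qw_term q w _ hq
                (or_introl eq_refl))),
      !(is_series_unique _ _ (is_series_extremal_qw_term q w _ hq
                (or_intror eq_refl))),
      !(is_series_unique _ _ (is_series_extremal_stieltjes q w _ hq
                (or_introl eq_refl))),
      !(is_series_unique _ _ (is_series_extremal_stieltjes q w _ hq
                (or_intror eq_refl))) in H.
    (* The slope term drops out with the integral of [f]. What remains is [1 - (-1) = 2] on the left
       against [c * 1 * 2 * 2] on the right, which forces [c >= 1 / 2]. *)
    rewrite (Rminus_diag_eq 1 1 eq_refl), Rmult_0_r, Rabs_pos_eq in H by lra.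
    lra.
Qed.
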